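(* Let $(G_i)_{i\in\mathbb{N}}$ and $(H_i)_{i\in\mathbb{N}}$ be sequences of games such that $G_i$ is Conway equivalent to $H_i$ for every $i\in\mathbb{N}$. Then $\sum^\bullet_{i\in\mathbb{N}} G_i$ is Conway equivalent to $\sum^\bullet_{i\in\mathbb{N}} H_i$.
   Context: Games are combinatorial games in Conway's sense: possibly infinite, partizan, Left and Right, no draws, no infinite runs, normal play. A game is written $\{G^L\mid G^R\}$; $+$ is the disjunctive sum; $G$ and $H$ are Conway equivalent iff $G-H$ is a second-player win. The sum $\sum^\bullet$. For a sequence $(H_i)_{i\in\mathbb{N}}$ and $n\in\mathbb{N}$, writing $H[i\mapsto K]$ for the sequence with $H_i$ replaced by $K$ and $H_0+\dots+H_j^L+\dots+H_m$ for the finite sum $H_0+\dots+H_m$ with $H_j$ replaced by a Left option of $H_j$, define (by transfinite induction on the natural sum of the birthdays of $H_0,\dots,H_n$) $(\sum^\bullet_i H_i)/R,n=\{\,(\sum^\bullet H[i\mapsto H_i^L])/R,n\ (i\le n),\ \ H_0+\dots+H_j^L+\dots+H_m\ (m\ge n,\ j\le m)\ \mid\ (\sum^\bullet H[i\mapsto H_i^R])/R,n\ (i\le n)\,\}$, $(\sum^\bullet_i H_i)/L,n=\{\,(\sum^\bullet H[i\mapsto H_i^L])/L,n\ (i\le n)\ \mid\ (\sum^\bullet H[i\mapsto H_i^R])/L,n\ (i\le n),\ \ H_0+\dots+H_j^R+\dots+H_m\ (m\ge n,\ j\le m)\,\}$, and $\sum^\bullet_{i\in\mathbb{N}} G_i=\{\,(\sum^\bullet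 G[i\mapsto G_i^L])/L,n\ (n\in\mathbb{N},\ i\le n)\mid(\sum^\bullet G[i\mapsto G_i^R])/R,n\ (n\in\mathbb{N},\ i\le n)\,\}$. Informally: the first player chooses $n$ and moves on some index $\le n$; thereafter both players move on indices $\le n$ until, at some turn of his, the second player chooses $m\ge n$ and moves on an index $\le m$; then play continues on the finite sum of the current positions of $G_0,\dots,G_m$. *)

(* Defs.v *)
From Stdlib Require Import FunctionalExtensionality.
From mathcomp Require Import all_boot.

Set Implicit Arguments.
Unset Strict Implicit.
Unset Printing Implicit Defensive.

Inductive player : Type := Left | Right.

Definition opponent (p : player) : player :=
  match p with Left => Right | Right => Left end.

(* The game { G^L | G^R } is given by the families of its options, indexed by
   arbitrary types: the Left options are [move Left x] for [x : moves Left],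
   the Right options are [move Right x] for [x : moves Right].  Being an
   inductive type, [game] has no infinite run. *)
Inductive game : Type :=
  Game (moves : player -> Type) (move : forall p, moves p -> game).

Definition moves (G : game) (p : player) : Type :=
  match G with Game M _ => M p end.

Definition option_of (G : game) (p : player) : moves G p -> game :=
  match G with Game _ f => f p end.

Arguments option_of G {p} x.

Fixpoint neg (G : game) : game :=
  match G with
  | Game M f => Game (fun p (x : M (opponent p)) => neg (f (opponent p) x))
  end.

Fixpoint add (G : game) : game -> game :=
  match G with
  | Game M f => fix addG (H : game) : game :=
    match H with
    | Game N g => Game (fun p (x : (M p + N p)%type) =>
                          match x with
                          | inl a => add (f p a) H
                          | inr b => addG (g p b)
                          end)
    end
  end.

(* Normal play: a player who has to move and cannot loses. *)
Fixpoint wins_moving_first (p : player) (G : game) {struct G} : Prop :=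
  match G with
  | Game M f => exists x : M p, wins_moving_second p (f p x)
  end
with wins_moving_second (p : player) (G : game) {struct G} : Prop :=
  match G with
  | Game M f => forall x : M (opponent p), wins_moving_first p (f (opponent p) x)
  end.

Definition second_player_win (G : game) : Prop :=
  forall p, wins_moving_second p G.

Definition conway_equiv (G H : game) : Prop :=
  second_player_win (add G (neg H)).

Definition upd (H : nat -> game) (i : nat) (K : game) : nat -> game :=
  fun k => if k == i then K else H k.

(* H_0 + ... + H_m, with [m] included *)
Fixpoint fsum (H : nat -> game) (m : nat) : game :=
  match m with
  | 0 => H 0
  | m'.+1 => add (fsum H m') (H m'.+1)
  end.

(* [step n H' H]: [H'] is [H] after a move of either player on an index [<= n].
   Its well-foundedness replaces the induction on the natural sum of the
   birthdays of H_0, ..., H_n. *)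
Variant step (n : nat) (H' H : nat -> game) : Prop :=
  Step i p (x : moves (H i) p) of i <= n & H' = upd H i (option_of (H i) x).

Lemma step_wf n : well_founded (step n).
Proof.
pose stepk k (H' H : nat -> game) := exists i p (x : moves (H i) p),
  i < k /\ H' = upd H i (option_of (H i) x).
have wfk k H : Acc (stepk k) H.
  elim: k H => [|k IHk] H; first by split=> H' [i [p [x []]]].
  move: {2}(H k) (erefl (H k)) => g; elim: g H => M f IHf H.
  elim: {H}(IHk H) => H _ IH HkE; split=> H' [i [p [x [lt_ik ->]]]].
  move: lt_ik; rewrite ltnS leq_eqVlt => /orP[/eqP ik | lt_ik].
    subst i; move: x; rewrite HkE /= => x.
    by apply: (IHf p x); rewrite /upd eqxx.
  apply: IH; first by exists i, p, x.
  by rewrite /upd gtn_eqF.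
move=> H; elim: {H}(wfk n.+1 H) => H _ IH; split=> H' [i p x le_in E].
by apply: IH; exists i, p, x.
Qed.

(* Moves of player [p] in (sum^. H)/s,n, where [s] is the player who started:
   either the bound [n] is kept, or the opponent of [s] chooses [m >= n]. *)
Variant bounded_move (s : player) (n : nat) (H : nat -> game) (p : player)
    : Type :=
  | Keep i (le_in : i <= n) (x : moves (H i) p)
  | Close m j (le_nm : n <= m) (le_jm : j <= m) (x : moves (H j) p)
      (not_s : p = opponent s).

Definition bounded_sum_body (s : player) (n : nat) (H : nat -> game)
    (rec : forall H', step n H' H -> game) : game :=
  Game (fun p (mv : bounded_move s n H p) =>
    match mv with
    | Keep i le_in x => rec (upd H i (option_of (H i) x)) (Step le_in erefl)
    | Close m j _ _ x _ => fsum (upd H j (option_of (H j) x)) m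
    end).

(* (sum^. H)/s,n *)
Definition bounded_sum (s : player) (n : nat) : (nat -> game) -> game :=
  Fix (@step_wf n) (fun=> game) (@bounded_sum_body s n).

Lemma bounded_sumE s n H :
  bounded_sum s n H =
  Game (fun p (mv : bounded_move s n H p) =>
    match mv with
    | Keep i _ x => bounded_sum s n (upd H i (option_of (H i) x))
    | Close m j _ _ x _ => fsum (upd H j (option_of (H j) x)) m
    end).
Proof.
rewrite /bounded_sum Fix_eq // => {}H r1 r2 eq_r.
by congr bounded_sum_body; do 2![apply: functional_extensionality_dep => ?].
Qed.

Variant opening_move (G : nat -> game) (p : player) : Type :=
  Open n i (le_in : i <= n) (x : moves (G i) p).

(* sum^. G *)
Definition bullet_sum (G : nat -> game) : game :=
  Game (fun p (mv : opening_move G p) =>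
    match mv with
    | Open n i _ x => bounded_sum p n (upd G i (option_of (G i) x))
    end).

(* Main.v *)
Require Import Defs.
From mathcomp Require Import all_boot.

Set Implicit Arguments.
Unset Strict Implicit.
Unset Printing Implicit Defensive.

(* Call [dominated p G H] the fact that [p] wins [G - H] moving second (G <= H
   for p = Right, G >= H for p = Left).  A domination between all pairs
   (G_i, H_i) gives one between the sums, where [p] locally answers each move on
   an index [i] in [G_i - H_i].  For p = Right, the only difficulty is that the
   answer may fall in the same sum as the move, so that the two sums get into
   different phases.  The dominations that [p] has to maintain are then

     (sum G)/L,n <= sum^. H,                 sum^. G <= (sum H)/R,n,
     (sum G)/L,n <= H_0 + ... + H_m,         G_0 + ... + G_m <= (sum H)/R,n

   for m >= n, besides those between two sums in the same phase.  The key case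
   is (sum G)/L,n <= sum^. H when Left opens the second sum with a bound [m]:
   whichever sum the local answer falls in, Right closes that sum at
   [maxn m n]. *)

(** * Options of games and of their sums *)

Definition is_option (p : player) (G' G : game) : Prop :=
  exists x : moves G p, G' = option_of G x.

Lemma game_option_ind (P : game -> Prop) :
  (forall G, (forall p G', is_option p G' G -> P G') -> P G) ->
  forall G, P G.
Proof.
by move=> IH; elim=> M f IHf; apply: IH => p _ [x ->]; apply: IHf.
Qed.

Lemma opponentK : involutive opponent.
Proof. by case. Qed.

Lemma opponent_neq p : p <> opponent p.
Proof. by case: p. Qed.

Lemma wins_moving_firstP p G :
  wins_moving_first p G <->
  exists2 G', is_option p G' G & wins_moving_second p G'.
Proof.
case: G => M f; split=> [[x win] | [_ [x ->] win]]; last by exists x.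
by exists (f p x) => //; exists x.
Qed.

Lemma wins_moving_secondP p G :
  wins_moving_second p G <->
  forall G', is_option (opponent p) G' G -> wins_moving_first p G'.
Proof.
case: G => M f; split=> [win _ [x ->] | win x]; first exact: win.
by apply: win; exists x.
Qed.

Lemma is_option_add p K G H :
  is_option p K (add G H) <->
  (exists2 G', is_option p G' G & K = add G' H) \/
  (exists2 H', is_option p H' H & K = add G H').
Proof.
case: G H => M f [N g]; split.
  case=> -[x|x] ->; [left; exists (f p x) | right; exists (g p x)] => //.
    by exists x.
  by exists x.
by case=> -[_ [x ->] ->]; [exists (inl x) | exists (inr x)].
Qed.

Lemma is_option_neg p K H :
  is_option p K (neg H) <->
  exists2 H', is_option (opponent p) H' H & K = neg H'.
Proof.
case: H => M f; split=> [[x ->] | [_ [x ->] ->]]; last by exists x.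
by exists (f _ x) => //; exists x.
Qed.

Lemma is_option_fsum p K H m :
  is_option p K (fsum H m) <->
  exists i X, [/\ i <= m, is_option p X (H i) & K = fsum (upd H i X) m].
Proof.
have fsum_upd_gt n i X : n < i -> fsum (upd H i X) n = fsum H n.
  elim: n => [|n IHn] lt_ni /=; first by rewrite /upd ltn_eqF.
  by rewrite IHn 1?ltnW // /upd ltn_eqF.
elim: m K => [|m IHm] K.
  split=> [opt | [i [X []]]]; first by exists 0, K; split.
  by rewrite leqn0 => /eqP-> optX ->; rewrite /= /upd eqxx.
split=> [/is_option_add[[K' /IHm[i [X [le_im optX ->]]] ->] | [X optX ->]] |].
- exists i, X; split=> //; first exact: leqW.
  by rewrite /= [in RHS]/upd gtn_eqF.
- by exists m.+1, X; split=> //=; rewrite fsum_upd_gt // /upd eqxx.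
case=> i [X []]; rewrite leq_eqVlt => /predU1P[-> | lt_im] optX -> /=.
  apply/is_option_add; right; exists X => //.
  by rewrite fsum_upd_gt // /upd eqxx.
apply/is_option_add; left; exists (fsum (upd H i X) m).
  by apply/IHm; exists i, X; split.
by rewrite /upd gtn_eqF.
Qed.

Lemma is_option_bounded_sum p K s n H :
  is_option p K (bounded_sum s n H) <->
  (exists i X,
     [/\ i <= n, is_option p X (H i) & K = bounded_sum s n (upd H i X)]) \/
  (p = opponent s /\ exists m j X,
     [/\ n <= m, j <= m, is_option p X (H j) & K = fsum (upd H j X) m]).
Proof.
rewrite bounded_sumE; split.
  case=> -[i le_in x | m j le_nm le_jm x p_s] ->; [left | right; split=> //].
    by exists i, (option_of (H i) x); split=> //; exists x.
  by exists m, j, (option_of (H j) x); split=> //; exists x.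
case=> [[i [_ [le_in [x ->] ->]]] | [p_s [m [j [_ [le_nm le_jm [x ->] ->]]]]]].
  by exists (Keep s le_in x).
by exists (Close le_nm le_jm x p_s).
Qed.

Lemma is_option_bullet_sum p K G :
  is_option p K (bullet_sum G) <->
  exists n i X,
    [/\ i <= n, is_option p X (G i) & K = bounded_sum p n (upd G i X)].
Proof.
split=> [[[n i le_in x] ->] | [n [i [_ [le_in [x ->] ->]]]]].
  by exists n, i, (option_of (G i) x); split=> //; exists x.
by exists (Open le_in x).
Qed.

(** * Domination and simulation *)

Definition dominated (p : player) (G H : game) : Prop :=
  wins_moving_second p (add G (neg H)).

(** In [G - H], player [p] moves in [H] as its opponent. With [R] abstract, the same shape serves
    for won positions and for invariants. *)
Definition answers (p : player) (R : game -> game -> Prop) (G H : game) : Prop :=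
  (exists2 G', is_option p G' G & R G' H) \/
  (exists2 H', is_option (opponent p) H' H & R G H').

Lemma wins_moving_first_sub p G H :
  wins_moving_first p (add G (neg H)) <-> answers p (dominated p) G H.
Proof.
split=> [/wins_moving_firstP[_ /is_option_add[[G' optG ->]|[N optN ->]]] win |].
- by left; exists G'.
- by case/is_option_neg: optN win => H' optH -> win; right; exists H'.
case=> [[G' optG dom] | [H' optH dom]]; apply/wins_moving_firstP.
  by exists (add G' (neg H)) => //; apply/is_option_add; left; exists G'.
exists (add G (neg H')) => //; apply/is_option_add; right.
by exists (neg H') => //; apply/is_option_neg; exists H'.
Qed.

Lemma dominatedP p G H :
  dominated p G H <->
  (forall G', is_option (opponent p) G' G -> answers p (dominated p) G' H) /\
  (forall H', is_option p H' H -> answers p (dominated p) G H').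
Proof.
split=> [/wins_moving_secondP win | [winG winH]].
  split=> [G' optG | H' optH]; apply/wins_moving_first_sub/win/is_option_add.
    by left; exists G'.
  right; exists (neg H') => //; apply/is_option_neg; exists H' => //.
  by rewrite opponentK.
apply/wins_moving_secondP=> _ /is_option_add[[G' optG ->] | [N optN ->]].
  exact/wins_moving_first_sub/winG.
case/is_option_neg: optN => H'; rewrite opponentK => optH ->.
exact/wins_moving_first_sub/winH.
Qed.

Definition symmetric_family (R : player -> game -> game -> Prop) : Prop :=
  forall p G H, R p G H -> R (opponent p) H G.

Lemma answers_sym R p G H :
  symmetric_family R ->
  answers (opponent p) (R (opponent p)) H G -> answers p (R p) G H.
Proof.
move=> symR [[H' optH] | [G']]; last rewrite opponentK => optG.
  by move/symR; rewrite opponentK; right; exists H'.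
by move/symR; rewrite opponentK; left; exists G'.
Qed.

(** [R] is an invariant that [p] can restore after each move of the opponent, so [p] always has a
    reply, and induction on both components ends the play. Moves in the second component are moves
    in the first one after the swap given by [symR]. *)
Lemma simulation_dominated (R : player -> game -> game -> Prop) :
  symmetric_family R ->
  (forall p G H, R p G H ->
     forall G', is_option (opponent p) G' G -> answers p (R p) G' H) ->
  forall p G H, R p G H -> dominated p G H.
Proof.
move=> symR simR p G H.
(* Strengthened so that each induction step is a single move. *)
suff [] : (R p G H -> dominated p G H) /\
          (answers p (R p) G H -> answers p (dominated p) G H) by [].
elim/game_option_ind: G H => G IHG; elim/game_option_ind=> H IHH.
split=> [RGH | [[G' optG RGH] | [H' optH RGH]]].
- apply/dominatedP; split=> [G' optG | H' optH].
    by case: (IHG _ _ optG H) => _; apply; apply: simR RGH _ optG.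
  case: (IHH _ _ optH) => _; apply; apply: answers_sym => //.
  by apply: simR (symR _ _ _ RGH) _ _; rewrite opponentK.
- by left; exists G' => //; case: (IHG _ _ optG H) => + _; apply.
- by right; exists H' => //; case: (IHH _ _ optH) => + _; apply.
Qed.

(** Swapping the components and the players gives the same play, though not literally the same game
    tree. Hence a simulation, by the closure of [dominated] under this swap. *)
Lemma dominated_sym p G H : dominated p G H -> dominated (opponent p) H G.
Proof.
pose R p G H := dominated p G H \/ dominated (opponent p) H G.
have symR : symmetric_family R.
  by move=> q X Y [dom | dom]; [right; rewrite opponentK | left].
have subR q X Y : answers q (dominated q) X Y -> answers q (R q) X Y.
  by case=> [[Z opt dom]|[Z opt dom]]; [left | right]; exists Z => //; left.
move=> dom; apply: (simulation_dominated symR); last by right; rewrite opponentK.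
move=> q X Y [/dominatedP[ansX _] | /dominatedP[_ ansX]] X' optX.
  exact/subR/ansX.
exact/answers_sym/subR/ansX.
Qed.

(** * Sequences of games and phases of play *)

Definition seq_dominated p (G H : nat -> game) := forall i, dominated p (G i) (H i).

Lemma seq_dominated_sym p G H :
  seq_dominated p G H -> seq_dominated (opponent p) H G.
Proof. by move=> dom i; apply/dominated_sym/dom. Qed.

(** The updates stay unreduced so that the new sequences are literally those occurring in the
    options of the sums. *)
Lemma seq_dominated_answer p G H i X :
  seq_dominated p G H -> is_option (opponent p) X (G i) ->
  (exists2 X', is_option p X' (upd G i X i) &
     seq_dominated p (upd (upd G i X) i X') H) \/
  (exists2 Y, is_option (opponent p) Y (H i) &
     seq_dominated p (upd G i X) (upd H i Y)).
Proof.
move=> dom /(proj1 (proj1 (dominatedP _ _ _) (dom i)))[] [Y optY domY].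
  left; exists Y; first by rewrite /upd eqxx.
  by move=> k; rewrite /upd; case: eqP => // ->.
by right; exists Y => // k; rewrite /upd; case: eqP => // ->.
Qed.

(** In the phases that pair sums of different kinds, the starter of the bounded sum is such that
    only [p] can close it. The bound [n <= m] allows [p] to close at [m] itself, and keeps every
    index of the bounded sum available in the finite one. *)
Variant phase_dominated (p : player) : game -> game -> Prop :=
  | PhaseFsum G H m of seq_dominated p G H :
      phase_dominated p (fsum G m) (fsum H m)
  | PhaseFsumBounded G H m n of n <= m & seq_dominated p G H :
      phase_dominated p (fsum G m) (bounded_sum p n H)
  | PhaseBoundedFsum G H m n of n <= m & seq_dominated p G H :
      phase_dominated p (bounded_sum (opponent p) n G) (fsum H m)
  | PhaseBounded s G H n of seq_dominated p G H :
      phase_dominated p (bounded_sum s n G) (bounded_sum s n H)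
  | PhaseBoundedBullet G H n of seq_dominated p G H :
      phase_dominated p (bounded_sum (opponent p) n G) (bullet_sum H)
  | PhaseBulletBounded G H n of seq_dominated p G H :
      phase_dominated p (bullet_sum G) (bounded_sum p n H)
  | PhaseBullet G H of seq_dominated p G H :
      phase_dominated p (bullet_sum G) (bullet_sum H).

Lemma phase_dominated_sym : symmetric_family phase_dominated.
Proof.
move=> p _ _ [] => [G H m|G H m n le_nm|G H m n le_nm|s G H n|G H n|G H n|G H];
  move/seq_dominated_sym=> dom.
- exact: PhaseFsum.
- by rewrite -[in bounded_sum p](opponentK p); apply: PhaseBoundedFsum.
- exact: PhaseFsumBounded.
- exact: PhaseBounded.
- exact: PhaseBulletBounded.
- by rewrite -[in bounded_sum p](opponentK p); apply: PhaseBoundedBullet.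
- exact: PhaseBullet.
Qed.

Lemma option_fsum p G i X m :
  i <= m -> is_option p X (G i) -> is_option p (fsum (upd G i X) m) (fsum G m).
Proof. by move=> le_im optX; apply/is_option_fsum; exists i, X. Qed.

Lemma option_keep p s n G i X :
  i <= n -> is_option p X (G i) ->
  is_option p (bounded_sum s n (upd G i X)) (bounded_sum s n G).
Proof.
by move=> le_in optX; apply/is_option_bounded_sum; left; exists i, X.
Qed.

Lemma option_close s n m G i X :
  n <= m -> i <= m -> is_option (opponent s) X (G i) ->
  is_option (opponent s) (fsum (upd G i X) m) (bounded_sum s n G).
Proof.
move=> le_nm le_im optX; apply/is_option_bounded_sum; right.
by split=> //; exists m, i, X.
Qed.

Lemma option_open p n G i X :
  i <= n -> is_option p X (G i) ->
  is_option p (bounded_sum p n (upd G i X)) (bullet_sum G).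
Proof.
by move=> le_in optX; apply/is_option_bullet_sum; exists n, i, X.
Qed.

Lemma phase_dominated_answer p X Y :
  phase_dominated p X Y ->
  forall X', is_option (opponent p) X' X ->
  answers p (phase_dominated p) X' Y.
Proof.
have closeL n m G i K : n <= m -> i <= m -> is_option p K (G i) ->
    is_option p (fsum (upd G i K) m) (bounded_sum (opponent p) n G).
  by rewrite -[p in is_option p]opponentK; apply: option_close.
case=> [G H m | G H m n le_nm | G H m n le_nm | s G H n | G H n | G H n | G H]
  dom X'.
- case/is_option_fsum=> i [K [le_im /(seq_dominated_answer dom)ans ->]].
  case: ans => -[K' optK' dom']; [left | right]; eexists.
  + exact: option_fsum optK'.
  + exact: PhaseFsum.
  + exact: option_fsum optK'.
  + exact: PhaseFsum.
- case/is_option_fsum=> i [K [le_im /(seq_dominated_answer dom)ans ->]].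
  case: ans => -[K' optK' dom']; [left | right]; eexists.
  + exact: option_fsum optK'.
  + exact: PhaseFsumBounded.
  (* The index [i] may exceed [n], so the answer closes the second sum, at the [m] of the first. *)
  + exact: option_close le_nm le_im optK'.
  + exact: PhaseFsum.
(* The opponent of [p] started this sum, hence cannot close it. *)
- case/is_option_bounded_sum=> [|[/opponent_neq//]].
  case=> i [K [le_in /(seq_dominated_answer dom)ans ->]].
  case: ans => -[K' optK' dom']; [left | right]; eexists.
  + exact: option_keep optK'.
  + exact: PhaseBoundedFsum.
  + by apply: option_fsum optK'; apply: leq_trans le_nm.
  + exact: PhaseBoundedFsum.
- case/is_option_bounded_sum=> [|[/(can_inj opponentK) <-]].
    case=> i [K [le_in /(seq_dominated_answer dom)ans ->]].
    case: ans => -[K' optK' dom']; [left | right]; eexists.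
    + exact: option_keep optK'.
    + exact: PhaseBounded.
    + exact: option_keep optK'.
    + exact: PhaseBounded.
  (* Here [s] is [p], and the opponent closes the first sum at [m]. An answer in the second sum
     closes it at the same [m]. *)
  case=> m [i [K [le_nm le_im /(seq_dominated_answer dom)ans ->]]].
  case: ans => -[K' optK' dom']; [left | right]; eexists.
  + exact: option_fsum optK'.
  + exact: PhaseFsumBounded.
  + exact: option_close le_nm le_im optK'.
  + exact: PhaseFsum.
- case/is_option_bounded_sum=> [|[/opponent_neq//]].
  case=> i [K [le_in /(seq_dominated_answer dom)ans ->]].
  case: ans => -[K' optK' dom']; [left | right]; eexists.
  + exact: option_keep optK'.
  + exact: PhaseBoundedBullet.
  (* Opening with the bound [n] of the first sum gives both sums the same starter and bound. *)
  + exact: option_open le_in optK'.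
  + exact: PhaseBounded.
(* The key case, mirrored: the opponent opens the first sum with [m], which may be smaller or larger
   than [n]. Closing at [maxn m n] is legal in either sum and dominates the bound of the sum left
   open. *)
- case/is_option_bullet_sum=> m [i [K [le_im]]].
  move=> /(seq_dominated_answer dom)ans ->.
  have le_iM : i <= maxn m n by rewrite leq_max le_im.
  case: ans => -[K' optK' dom']; [left | right]; eexists.
  + exact: closeL (leq_maxl m n) le_iM optK'.
  + by apply: PhaseFsumBounded; first exact: leq_maxr.
  + exact: option_close (leq_maxr m n) le_iM optK'.
  + by apply: PhaseBoundedFsum; first exact: leq_maxl.
- case/is_option_bullet_sum=> n [i [K [le_in]]].
  move=> /(seq_dominated_answer dom)ans ->.
  case: ans => -[K' optK' dom']; [left | right]; eexists.
  + exact: option_keep optK'.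
  + exact: PhaseBoundedBullet.
  + exact: option_open le_in optK'.
  + exact: PhaseBounded.
Qed.

Theorem theorem6p3 (G H : nat -> game) :
  (forall i, conway_equiv (G i) (H i)) ->
  conway_equiv (bullet_sum G) (bullet_sum H).
Proof.
move=> eqGH p; rewrite -/(dominated p _ _).
apply: (simulation_dominated phase_dominated_sym phase_dominated_answer).
by apply: PhaseBullet => i; apply: eqGH.
Qed.
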